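(* Let $\mathcal G$ be a finite groupoid and let $\mathcal H,\mathcal K$ be a match pair of subgroupoids of $\mathcal G$. Let $I_{\mathcal H,\mathcal K}$ be the linear endomorphism of $l^2(\mathcal G\times\mathcal G)$ defined by $$I_{\mathcal H,\mathcal K}(f)(x,y)=\begin{cases} f\big(x\,p_1(p_2(x)^{-1}y),\;p_2(x)^{-1}y\big)&\text{if } m(x)=r(y),\\ 0&\text{otherwise.}\end{cases}$$ Then $I_{\mathcal H,\mathcal K}$ is a multiplicative partial isometry over the base $(C(\mathcal G^0),\alpha,\beta,\hat\beta)$, where $\alpha(n)$, $\beta(n)$, $\hat\beta(n)$ are the multiplication operators on $l^2(\mathcal G)$ by $n\circ m$, $n\circ r$, $n\circ s$ respectively.
   Context: $\mathcal G$ has unit space $\mathcal G^0$, source $s$ and range $r$; $xy$ is defined iff $s(x)=r(y)$. For a subgroupoid $\mathcal K$, $\mathcal K^u=\{k\in\mathcal K:r(k)=u\}$. Subgroupoids $\mathcal H,\mathcal K$ of $\mathcal G$ form a match pair if $\mathcal G=\mathcal H\mathcal K=\{hk: h\in\mathcal H,k\in\mathcal K^{s(h)}\}$ and $\mathcal H\cap\mathcal K\subset\mathcal G^0$. Then $\mathcal H\cap\mathcal K=\mathcal G^0$ and every $g\in\mathcal G$ has a unique decomposition $g=p_1(g)p_2(g)$ with $p_1(g)\in\mathcal H$, $p_2(g)\in\mathcal K$. The middle map is $m=s\circ p_1=r\circ p_2:\mathcal G\to\mathcal G^0$. When $m(x)=r(y)$ all products in the formula are defined. Multiplicative partial isometry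 (for a commutative finite-dimensional base $N$ with minimal projections $(p_u)$): let $H$ be a finite-dimensional Hilbert space and $\alpha,\beta,\hat\beta$ injective non-degenerate representations of $N$ on $H$, commuting pairwise pointwise, with $tr\circ\alpha=tr\circ\beta=tr\circ\hat\beta$ ($tr$ the canonical trace of $\mathcal L(H)$). For two such representations put $e_{\sigma,\tau}=\sum_u\sigma(p_u)\otimes\tau(p_u)$. A multiplicative partial isometry over the base $(N,\alpha,\beta,\hat\beta)$ is a partial isometry $I$ on $H\otimes H$ with initial support $I^*I=e_{\hat\beta,\alpha}$ and final support $II^*=e_{\alpha,\beta}$, such that: (1) $I$ commutes with $\beta(N)\otimes\hat\beta(N)$; (2) $I(\alpha(n)\otimes\beta(n'))=(\hat\beta(n')\otimes\alpha(n))I$ for all $n,n'\in N$; (3) $I_{12}I_{13}I_{23}=I_{23}I_{12}$ (leg notation on $H^{\otimes3}$). Here $H=l^2(\mathcal G)$, $H\otimes H=l^2(\mathcal G\times\mathcal G)$. *)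

(* Defs.v *)
(* The scalars are the complex numbers R[i], for R : realType.               *)
From HB Require Import structures.
From mathcomp Require Import all_boot all_order all_algebra.
From mathcomp Require Import reals complex.

Set Implicit Arguments.
Unset Strict Implicit.
Unset Printing Implicit Defensive.

Import Order.TTheory GRing.Theory Num.Theory.
Local Open Scope ring_scope.

(* [gmul] is total so that no proof has to be passed to it; its value is      *)
(* unconstrained unless [src x = rng y], the case in which xy is defined.     *)
Record finGroupoid := FinGroupoid {
  arrow :> finType;
  unit_space : finType;
  src : arrow -> unit_space;
  rng : arrow -> unit_space;
  gunit : unit_space -> arrow;
  ginv : arrow -> arrow;
  gmul : arrow -> arrow -> arrow;
  src_unit : forall u, src (gunit u) = u;
  rng_unit : forall u, rng (gunit u) = u;
  src_mul : forall x y, src x = rng y -> src (gmul x y) = src y;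
  rng_mul : forall x y, src x = rng y -> rng (gmul x y) = rng x;
  gmulA : forall x y z, src x = rng y -> src y = rng z ->
    gmul x (gmul y z) = gmul (gmul x y) z;
  gmul1g : forall x, gmul (gunit (rng x)) x = x;
  gmulg1 : forall x, gmul x (gunit (src x)) = x;
  src_inv : forall x, src (ginv x) = rng x;
  rng_inv : forall x, rng (ginv x) = src x;
  gmulVg : forall x, gmul (ginv x) x = gunit (src x);
  gmulgV : forall x, gmul x (ginv x) = gunit (rng x)
}.

Section MatchPairs.
Variable G : finGroupoid.
Implicit Types H K : {set G}.

Definition subgroupoid H : Prop :=
  (forall x, x \in H -> ginv x \in H) /\
  (forall x y, x \in H -> y \in H -> src x = rng y -> gmul x y \in H).

Definition rfibre K (u : unit_space G) : {set G} := [set k in K | rng k == u].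

Definition match_pair H K : Prop :=
  [/\ subgroupoid H,
      subgroupoid K,
      [set gmul h k | h in H, k in rfibre K (src h)] = [set: G]
    & H :&: K \subset [set gunit u | u : unit_space G]].

(* The default value (g, g) is never used when H, K is a match pair, and the  *)
(* pair picked is then the only possible one: see [decompP], [decomp_uniq].   *)
Definition decomp H K (g : G) : G * G :=
  odflt (g, g)
    [pick hk : G * G | [&& hk.1 \in H, hk.2 \in rfibre K (src hk.1)
                         & g == gmul hk.1 hk.2]].

Definition p1 H K (g : G) : G := (decomp H K g).1.
Definition p2 H K (g : G) : G := (decomp H K g).2.

Definition middle H K (g : G) : unit_space G := src (p1 H K g).

Lemma decompP H K : match_pair H K -> forall g,
  [/\ p1 H K g \in H, p2 H K g \in K, src (p1 H K g) = rng (p2 H K g)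
    & g = gmul (p1 H K g) (p2 H K g)].
Proof.
case=> _ _ HK _ g; rewrite /p1 /p2 /decomp.
case: pickP => [[h k] /and3P[/= hH] | no].
  by rewrite inE => /andP[kK /eqP rk] /eqP gE; split.
have : g \in [set: G] by rewrite inE.
rewrite -HK => /imset2P[h k hH kK gE].
by move: (no (h, k)); rewrite /= hH kK gE eqxx.
Qed.

Lemma decomp_uniq H K : match_pair H K -> forall h k,
  h \in H -> k \in K -> src h = rng k ->
  p1 H K (gmul h k) = h /\ p2 H K (gmul h k) = k.
Proof.
move=> mp h k hH kK hk; have [aH bK ab gE] := decompP mp (gmul h k).
case: mp => -[HV HM] [KV KM] _ /subsetP HK1.
set a := p1 H K _ in aH ab gE *; set b := p2 H K _ in bK ab gE *.
have rah : rng a = rng h by rewrite -(rng_mul ab) -gE rng_mul.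
have sbk : src b = src k by rewrite -(src_mul ab) -gE src_mul.
have sVa : src (ginv a) = rng h by rewrite src_inv.
have sbV : src b = rng (ginv k) by rewrite rng_inv.
have e : gmul (ginv a) h = gmul b (ginv k).
  rewrite -[h in LHS]gmulg1 hk -gmulgV (gmulA hk) ?rng_inv // gE.
  rewrite -(gmulA ab) // (@gmulA _ (ginv a)) ?src_inv // ?rng_mul //.
  by rewrite gmulVg ab -{1}(rng_mul sbV) gmul1g.
have /HK1/imsetP[u _ eu] : gmul (ginv a) h \in H :&: K.
  rewrite inE (HM _ _ (HV _ aH) hH sVa) e.
  exact: KM _ _ bK (KV _ kK) sbV.
have uE : u = src a by rewrite -(rng_unit u) -eu rng_mul // rng_inv.
split.
  have := congr1 (gmul a) eu.
  rewrite (@gmulA _ a) ?rng_inv // gmulgV rah gmul1g => ->.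
  by rewrite uE gmulg1.
have rk : rng k = u by rewrite -hk -(src_mul sVa) eu src_unit.
have := congr1 (fun g => gmul g k) (etrans (esym e) eu).
by rewrite -(@gmulA _ b) ?src_inv // gmulVg -sbk gmulg1 -rk gmul1g.
Qed.

Lemma middleE H K : match_pair H K -> forall g, middle H K g = rng (p2 H K g).
Proof. by move=> mp g; case: (decompP mp g). Qed.

End MatchPairs.

Local Open Scope complex_scope.

(* The same function space serves as the finite-dimensional Hilbert space     *)
(* l^2(X) and as the commutative C*-algebra C(X) with pointwise operations;   *)
(* up to isomorphism there are no others. Tensor products of Hilbert spaces   *)
(* are identified with function spaces on products: l^2(X) (x) l^2(X) is      *)
(* l^2(X * X), and the threefold tensor power is l^2(X * X * X).              *)
Notation l2 R X := {ffun X -> R[i]^o}.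
Notation Calg R X := {ffun X -> R[i]^o} (only parsing).

Section Operators.
Variable R : realType.

Definition dirac (X : finType) (x : X) : l2 R X := [ffun y => (y == x)%:R].

Definition dotp (X : finType) (f g : l2 R X) : R[i] :=
  \sum_x f x * ((g x : R[i])^* )%R.

Definition adjoint_fun (X : finType) (T : 'End(l2 R X)) (g : l2 R X) : l2 R X :=
  [ffun x => dotp g (T (dirac x))].

Fact adjoint_is_linear (X : finType) (T : 'End(l2 R X)) :
  linear (adjoint_fun T).
Proof.
move=> c f g; apply/ffunP=> x; rewrite !ffunE /dotp scaler_sumr -big_split /=.
by apply: eq_bigr => y _; rewrite !ffunE mulrDl scalerAl.
Qed.
HB.instance Definition _ (X : finType) T := GRing.isLinear.Build R[i] (l2 R X) (l2 R X)
  _ (adjoint_fun T) (adjoint_is_linear T).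

Definition adjoint (X : finType) (T : 'End(l2 R X)) : 'End(l2 R X) :=
  linfun (adjoint_fun T).

Lemma ffun_dirac (X : finType) (f : l2 R X) : f = \sum_x f x *: dirac x.
Proof.
apply/ffunP=> y; rewrite sum_ffunE (bigD1 y) //= !ffunE eqxx big1 => [|x xy].
  by rewrite addr0 [_ *: _]mulr1.
by rewrite !ffunE eq_sym (negPf xy) [_ *: _]mulr0.
Qed.

Lemma adjointP (X : finType) (T : 'End(l2 R X)) (f g : l2 R X) :
  dotp (T f) g = dotp f (adjoint T g).
Proof.
rewrite [X in T X]ffun_dirac linear_sum /dotp.
under eq_bigr do rewrite sum_ffunE mulr_suml.
rewrite exchange_big; apply: eq_bigr => x _.
rewrite lfunE /= !ffunE rmorph_sum mulr_sumr; apply: eq_bigr => y _.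
by rewrite linearZ !ffunE rmorphM /= conjCK [(g y)^* * _]mulrC mulrA.
Qed.

Definition trace (X : finType) (T : 'End(l2 R X)) : R[i] :=
  \sum_x dotp (T (dirac x)) (dirac x).

Definition partial_isometry (X : finType) (T : 'End(l2 R X)) : Prop :=
  forall f, (forall g, T g = 0 -> dotp f g = 0) ->
    dotp (T f) (T f) = dotp f f.

Definition tens_fun (X Y : finType) (S : 'End(l2 R X)) (T : 'End(l2 R Y))
    (F : l2 R (X * Y)) : l2 R (X * Y) :=
  [ffun q => S [ffun a => T [ffun b => F (a, b)] q.2] q.1].

Fact tens_is_linear (X Y : finType) (S : 'End(l2 R X)) (T : 'End(l2 R Y)) :
  linear (tens_fun S T).
Proof.
move=> c F F'; apply/ffunP=> -[x y]; rewrite !ffunE /=.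
set f := finfun _; set g := finfun _; set g' := finfun _.
suff -> : f = c *: g + g' by rewrite linearP !ffunE.
apply/ffunP=> a; rewrite !ffunE; set p := finfun _; set q := finfun _.
set q' := finfun _.
suff -> : p = c *: q + q' by rewrite linearP !ffunE.
by apply/ffunP=> b; rewrite !ffunE.
Qed.
HB.instance Definition _ (X Y : finType) S T := GRing.isLinear.Build R[i]
  (l2 R (X * Y)) (l2 R (X * Y)) _ (tens_fun S T) (tens_is_linear S T).

Definition tens (X Y : finType) (S : 'End(l2 R X)) (T : 'End(l2 R Y)) :
  'End(l2 R (X * Y)) := linfun (tens_fun S T).

Lemma tensE (X Y : finType) (S : 'End(l2 R X)) (T : 'End(l2 R Y))
    (f : l2 R X) (g : l2 R Y) :
  tens S T [ffun q => f q.1 * g q.2] = [ffun q => S f q.1 * T g q.2].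
Proof.
apply/ffunP=> -[x y]; rewrite lfunE /= !ffunE /=.
have -> : [ffun a => T [ffun b => [ffun q => f q.1 * g q.2] (a, b)] y]
          = T g y *: f.
  apply/ffunP=> a; rewrite !ffunE [RHS]mulrC.
  have -> : [ffun b => [ffun q => f q.1 * g q.2] (a, b)] = f a *: g.
    by apply/ffunP=> b; rewrite !ffunE.
  by rewrite linearZ ffunE.
by rewrite linearZ ffunE [LHS]mulrC.
Qed.

(* Leg notation: [legij T] applies T to the i-th and j-th tensor factors.     *)
Definition leg12_fun (X : finType) (T : 'End(l2 R (X * X)))
    (F : l2 R (X * X * X)) : l2 R (X * X * X) :=
  [ffun q => let: (x, y, z) := q in T [ffun p => F (p.1, p.2, z)] (x, y)].

Definition leg13_fun (X : finType) (T : 'End(l2 R (X * X)))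
    (F : l2 R (X * X * X)) : l2 R (X * X * X) :=
  [ffun q => let: (x, y, z) := q in T [ffun p => F (p.1, y, p.2)] (x, z)].

Definition leg23_fun (X : finType) (T : 'End(l2 R (X * X)))
    (F : l2 R (X * X * X)) : l2 R (X * X * X) :=
  [ffun q => let: (x, y, z) := q in T [ffun p => F (x, p.1, p.2)] (y, z)].

Fact leg12_is_linear (X : finType) T : linear (@leg12_fun X T).
Proof.
move=> c F F'; apply/ffunP=> -[[x y] z]; rewrite !ffunE.
set f := finfun _; set g := finfun _; set g' := finfun _.
suff -> : f = c *: g + g' by rewrite linearP !ffunE.
by apply/ffunP=> p; rewrite !ffunE.
Qed.

Fact leg13_is_linear (X : finType) T : linear (@leg13_fun X T).
Proof.
move=> c F F'; apply/ffunP=> -[[x y] z]; rewrite !ffunE.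
set f := finfun _; set g := finfun _; set g' := finfun _.
suff -> : f = c *: g + g' by rewrite linearP !ffunE.
by apply/ffunP=> p; rewrite !ffunE.
Qed.

Fact leg23_is_linear (X : finType) T : linear (@leg23_fun X T).
Proof.
move=> c F F'; apply/ffunP=> -[[x y] z]; rewrite !ffunE.
set f := finfun _; set g := finfun _; set g' := finfun _.
suff -> : f = c *: g + g' by rewrite linearP !ffunE.
by apply/ffunP=> p; rewrite !ffunE.
Qed.

HB.instance Definition _ (X : finType) T := GRing.isLinear.Build R[i]
  (l2 R (X * X * X)) (l2 R (X * X * X)) _ (leg12_fun T) (@leg12_is_linear X T).
HB.instance Definition _ (X : finType) T := GRing.isLinear.Build R[i]
  (l2 R (X * X * X)) (l2 R (X * X * X)) _ (leg13_fun T) (@leg13_is_linear X T).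
HB.instance Definition _ (X : finType) T := GRing.isLinear.Build R[i]
  (l2 R (X * X * X)) (l2 R (X * X * X)) _ (leg23_fun T) (@leg23_is_linear X T).

Definition leg12 (X : finType) (T : 'End(l2 R (X * X))) :
  'End(l2 R (X * X * X)) := linfun (leg12_fun T).
Definition leg13 (X : finType) (T : 'End(l2 R (X * X))) :
  'End(l2 R (X * X * X)) := linfun (leg13_fun T).
Definition leg23 (X : finType) (T : 'End(l2 R (X * X))) :
  'End(l2 R (X * X * X)) := linfun (leg23_fun T).

Definition star (U : finType) (n : Calg R U) : Calg R U :=
  [ffun u => ((n u : R[i])^* )%R].

Definition minproj (U : finType) (u : U) : Calg R U :=
  [ffun v => (v == u)%:R].

Record representation (U X : finType) (sigma : Calg R U -> 'End(l2 R X)) :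
    Prop := Representation {
  repr_linear : linear sigma;
  repr_mul : forall n n', sigma (n * n') = (sigma n \o sigma n')%VF;
  repr_star : forall n, sigma (star n) = adjoint (sigma n)
}.

Definition nondegenerate (U X : finType) (sigma : Calg R U -> 'End(l2 R X)) :
    Prop :=
  forall f : l2 R X, exists s : seq (Calg R U * l2 R X),
    f = \sum_(q <- s) sigma q.1 q.2.

Definition commuting (U X : finType) (sigma tau : Calg R U -> 'End(l2 R X)) :
    Prop :=
  forall n n', (sigma n \o tau n')%VF = (tau n' \o sigma n)%VF.

Definition e_ (U X : finType) (sigma tau : Calg R U -> 'End(l2 R X)) :
    'End(l2 R (X * X)) :=
  \sum_u tens (sigma (minproj u)) (tau (minproj u)).

Record mpi_base (U X : finType)
    (alpha beta betahat : Calg R U -> 'End(l2 R X)) : Prop := MpiBase {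
  base_repr : [/\ representation alpha, representation beta
                & representation betahat];
  base_inj : [/\ injective alpha, injective beta & injective betahat];
  base_nondeg : [/\ nondegenerate alpha, nondegenerate beta
                  & nondegenerate betahat];
  base_comm : [/\ commuting alpha beta, commuting alpha betahat
                & commuting beta betahat];
  base_trace : forall n, trace (alpha n) = trace (beta n) /\
                         trace (beta n) = trace (betahat n)
}.

Record mult_partial_isometry (U X : finType)
    (alpha beta betahat : Calg R U -> 'End(l2 R X))
    (I : 'End(l2 R (X * X))) : Prop := MultPartialIsometry {
  mpi_baseP : mpi_base alpha beta betahat;
  mpi_partial_isometry : partial_isometry I;
  mpi_initial : (adjoint I \o I)%VF = e_ betahat alpha;
  mpi_final : (I \o adjoint I)%VF = e_ alpha beta;
  mpi_commute : forall n n',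
    (I \o tens (beta n) (betahat n'))%VF =
    (tens (beta n) (betahat n') \o I)%VF;
  mpi_intertwine : forall n n',
    (I \o tens (alpha n) (beta n'))%VF =
    (tens (betahat n') (alpha n) \o I)%VF;
  mpi_pentagon :
    (leg12 I \o leg13 I \o leg23 I)%VF = (leg23 I \o leg12 I)%VF
}.

Definition mulop_fun (U X : finType) (phi : X -> U) (n : Calg R U)
    (f : l2 R X) : l2 R X := [ffun x => n (phi x) * f x].

Fact mulop_is_linear (U X : finType) (phi : X -> U) n :
  linear (mulop_fun phi n).
Proof.
move=> c f g; apply/ffunP=> x; rewrite !ffunE mulrDr; congr (_ + _).
exact: mulrCA.
Qed.
HB.instance Definition _ (U X : finType) phi n := GRing.isLinear.Build R[i]
  (l2 R X) (l2 R X) _ (@mulop_fun U X phi n) (mulop_is_linear phi n).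

Definition mulop (U X : finType) (phi : X -> U) (n : Calg R U) :
  'End(l2 R X) := linfun (mulop_fun phi n).

Definition I_fun (G : finGroupoid) (H K : {set G}) (f : l2 R (G * G)) :
    l2 R (G * G) :=
  [ffun q : G * G => let: (x, y) := q in
    if middle H K x == rng y then
      f (gmul x (p1 H K (gmul (ginv (p2 H K x)) y)), gmul (ginv (p2 H K x)) y)
    else 0].

Fact I_is_linear (G : finGroupoid) (H K : {set G}) : linear (@I_fun G H K).
Proof.
move=> c f g; apply/ffunP=> -[x y]; rewrite !ffunE; case: ifP => _ //.
by rewrite scaler0 addr0.
Qed.
HB.instance Definition _ (G : finGroupoid) H K := GRing.isLinear.Build R[i]
  (l2 R (G * G)) (l2 R (G * G)) _ (@I_fun G H K) (@I_is_linear G H K).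

Definition I_op (G : finGroupoid) (H K : {set G}) : 'End(l2 R (G * G)) :=
  linfun (@I_fun G H K).

End Operators.

Arguments mulop R {U X} phi n.
Arguments I_op R {G} H K.

(* Main.v *)
Require Import Defs.
From HB Require Import structures.
From mathcomp Require Import all_boot all_order all_algebra.
From mathcomp Require Import reals complex.

(** Every operator in the statement is a partial pullback, F |-> F o t on a
    domain D and 0 off D, so each axiom becomes a statement about arrows.

    For I the map is t(x,y) = (x p1(z), z), with z = p2(x)^-1 y, and the domain
    is D = {m(x) = r(y)}.  It is a bijection of D onto E = {s(x) = m(z)}, with
    inverse (X,Z) |-> (x, p2(x) Z), where x = X p1(Z)^-1 ([actK], [coactK]).
    The adjoint of a pullback along a partial bijection is the pullback along
    the inverse ([adjoint_pullback]), so I*I and II* are the indicators of E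
    and D, which are the projections e_ of the base, and I is a partial isometry.

    Axioms (1), (2) and (3) rest on the equivariance of the decomposition,
    p1(hg) = h p1(g), p2(hg) = p2(g), p1(gk) = p1(g), p2(gk) = p2(g)k for
    h in H and k in K ([decomp_mulH], [decomp_mulK]).  Applied to the elements
    x p1(z) = p1(x) (p2(x) p1(z)) and y = (p2(x) p1(z)) p2(z), it gives
    m(x p1(z)) = m(y) and p2(x p1(z)) p2(z) = p2(y) ([middle_act], [p2_act]):
    the first is the intertwining relation, the second the heart of the
    pentagon relation.

    The equality of the traces says that the fibres of m, r and s over a unit
    are equipotent.  For r and s inversion is a bijection.  For m and r, write
    x = hk = k'h' with h, h' in H and k, k' in K: the map x |-> h^-1 k' = k h'^-1
    is an involution exchanging r and m ([twist]). *)

Set Implicit Arguments.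
Unset Strict Implicit.
Unset Printing Implicit Defensive.

Import GRing.Theory.
Local Open Scope ring_scope.
Local Open Scope complex_scope.

(** * Computing in a groupoid *)

Section Groupoid.
Variable G : finGroupoid.
Implicit Types x y z : G.

Lemma gmulKg x y : src x = rng y -> gmul (ginv x) (gmul x y) = y.
Proof. by move=> xy; rewrite gmulA ?src_inv // gmulVg xy gmul1g. Qed.

Lemma gmulKVg x y : rng x = rng y -> gmul x (gmul (ginv x) y) = y.
Proof. by move=> xy; rewrite gmulA ?src_inv ?rng_inv // gmulgV xy gmul1g. Qed.

Lemma gmulgK x y : src x = rng y -> gmul (gmul x y) (ginv y) = x.
Proof. by move=> xy; rewrite -gmulA ?rng_inv // gmulgV -xy gmulg1. Qed.

Lemma gmulgKV x y : src x = src y -> gmul (gmul x (ginv y)) y = x.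
Proof. by move=> xy; rewrite -gmulA ?src_inv ?rng_inv // gmulVg -xy gmulg1. Qed.

Lemma ginv_uniq x y : src x = rng y -> gmul x y = gunit (rng x) -> y = ginv x.
Proof.
move=> xy e; rewrite -[LHS](gmulKg xy) e.
by rewrite -{2}[ginv x]gmulg1 src_inv.
Qed.

Lemma ginvK x : ginv (ginv x) = x.
Proof. by apply/esym/ginv_uniq; rewrite ?src_inv // gmulVg rng_inv. Qed.

Lemma ginvM x y : src x = rng y -> ginv (gmul x y) = gmul (ginv y) (ginv x).
Proof.
move=> xy; have yx : src (ginv y) = rng (ginv x) by rewrite src_inv rng_inv.
apply/esym/ginv_uniq; first by rewrite src_mul // rng_mul // rng_inv.
by rewrite (gmulA _ yx) ?src_mul ?rng_inv // gmulgK // gmulgV rng_mul.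
Qed.

End Groupoid.

(** * The decomposition of a match pair *)

Section MatchPair.
Variables (G : finGroupoid) (H K : {set G}).
Hypothesis HK : match_pair H K.
Implicit Types x y z g h k : G.

Local Notation p1 := (p1 H K).
Local Notation p2 := (p2 H K).
Local Notation m := (middle H K).

Lemma subgroupoid_l : subgroupoid H. Proof. by case: HK. Qed.
Lemma subgroupoid_r : subgroupoid K. Proof. by case: HK. Qed.

Lemma p1_in g : p1 g \in H. Proof. by case: (decompP HK g). Qed.
Lemma p2_in g : p2 g \in K. Proof. by case: (decompP HK g). Qed.

Lemma src_p1 g : src (p1 g) = rng (p2 g).
Proof. by case: (decompP HK g). Qed.

Lemma decompE g : gmul (p1 g) (p2 g) = g.
Proof. by case: (decompP HK g). Qed.

Lemma rng_p1 g : rng (p1 g) = rng g.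
Proof. by rewrite -[in RHS](decompE g) rng_mul // src_p1. Qed.

Lemma src_p2 g : src (p2 g) = src g.
Proof. by rewrite -[in RHS](decompE g) src_mul // src_p1. Qed.

Lemma rng_p2 g : rng (p2 g) = m g.
Proof. by rewrite (middleE HK). Qed.

Lemma decomp_mulH h g : h \in H -> src h = rng g ->
  p1 (gmul h g) = gmul h (p1 g) /\ p2 (gmul h g) = p2 g.
Proof.
move=> hH hg; have hp : src h = rng (p1 g) by rewrite rng_p1.
rewrite -[in gmul h g](decompE g) gmulA ?src_p1 //.
apply: decomp_uniq => //; rewrite ?p2_in ?src_mul ?src_p1 //.
by case: subgroupoid_l => _; apply; rewrite ?p1_in.
Qed.

Lemma decomp_mulK g k : k \in K -> src g = rng k ->
  p1 (gmul g k) = p1 g /\ p2 (gmul g k) = gmul (p2 g) k.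
Proof.
move=> kK gk; have pk : src (p2 g) = rng k by rewrite src_p2.
rewrite -[in gmul g k](decompE g) -gmulA ?src_p1 //.
apply: decomp_uniq => //; rewrite ?p1_in ?rng_mul ?src_p1 //.
by case: subgroupoid_r => _; apply; rewrite ?p2_in.
Qed.

(** The two components of the arrow map defining the operator, and of its
    inverse: (x, y) |-> (act x y, coact x y) and (x, z) |-> (unact x z,
    uncoact x z). *)
Definition coact x y := gmul (ginv (p2 x)) y.
Definition act x y := gmul x (p1 (coact x y)).
Definition unact x z := gmul x (ginv (p1 z)).
Definition uncoact x z := gmul (p2 (unact x z)) z.

Section Act.
Variables x y : G.
Hypothesis xy : m x = rng y.

Lemma src_p2V : src (ginv (p2 x)) = rng y.
Proof. by rewrite src_inv rng_p2. Qed.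

Lemma rng_coact : rng (coact x y) = src x.
Proof. by rewrite rng_mul ?src_p2V // rng_inv src_p2. Qed.

Lemma src_coact : src (coact x y) = src y.
Proof. by rewrite src_mul ?src_p2V. Qed.

Lemma p2_coact : gmul (p2 x) (coact x y) = y.
Proof. by rewrite gmulKVg // rng_p2. Qed.

Lemma src_act_def : src x = rng (p1 (coact x y)).
Proof. by rewrite rng_p1 rng_coact. Qed.

Lemma rng_act : rng (act x y) = rng x.
Proof. by rewrite rng_mul // src_act_def. Qed.

Lemma src_act : src (act x y) = m (coact x y).
Proof. by rewrite src_mul // src_act_def. Qed.

(** The arrow c = p2(x) p1(z), where z = coact x y, controls both products:
    act x y = p1(x) c and y = c p2(z). *)
Let c := gmul (p2 x) (p1 (coact x y)).

Let cE : src (p2 x) = rng (p1 (coact x y)).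
Proof. by rewrite src_p2 src_act_def. Qed.

Let act_c : act x y = gmul (p1 x) c.
Proof. by rewrite gmulA ?src_p1 // decompE. Qed.

Let src_c : src c = rng (p2 (coact x y)).
Proof. by rewrite src_mul // src_p1. Qed.

Let rng_c : src (p1 x) = rng c.
Proof. by rewrite rng_mul // src_p1. Qed.

Let y_c : y = gmul c (p2 (coact x y)).
Proof. by rewrite -gmulA ?src_p1 // decompE p2_coact. Qed.

Lemma middle_act : m (act x y) = m y.
Proof.
have [_ e] := decomp_mulH (p1_in x) rng_c.
have [e' _] := decomp_mulK (p2_in _) src_c.
by rewrite act_c [in RHS]y_c -rng_p2 e -src_p1 /middle e'.
Qed.

Lemma p2_act : gmul (p2 (act x y)) (p2 (coact x y)) = p2 y.
Proof.
have [_ e] := decomp_mulH (p1_in x) rng_c.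
have [_ e'] := decomp_mulK (p2_in _) src_c.
by rewrite act_c [in RHS]y_c e e'.
Qed.

Lemma actK : unact (act x y) (coact x y) = x /\
  uncoact (act x y) (coact x y) = y.
Proof.
have e : unact (act x y) (coact x y) = x by rewrite [LHS]gmulgK // src_act_def.
by rewrite /uncoact e p2_coact.
Qed.

End Act.

Section Unact.
Variables x z : G.
Hypothesis xz : src x = m z.

Lemma src_unact : src (unact x z) = rng z.
Proof. by rewrite src_mul ?src_inv ?rng_inv // rng_p1. Qed.

Lemma rng_uncoact : rng (uncoact x z) = m (unact x z).
Proof. by rewrite rng_mul ?rng_p2 // src_p2 src_unact. Qed.

Lemma coactK : act (unact x z) (uncoact x z) = x /\
  coact (unact x z) (uncoact x z) = z.
Proof.
have e : coact (unact x z) (uncoact x z) = z.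
  by rewrite [LHS]gmulKg // src_p2 src_unact.
by rewrite /act e [gmul _ _]gmulgKV.
Qed.

End Unact.

(** These are the arrows at which the two sides of the pentagon relation
    evaluate a function of three variables.  The third coordinates agree because
    p2(X) p2(Y) = p2(y), the second by associativity; for the first,
    act Y Z = p1(Y) c and Z = c p2(coact Y Z) with the same
    c = p2(Y) p1(coact Y Z), whence p1(act Y Z) = p1(Y) p1(Z). *)
Lemma pentagon_arrows x y z : m x = rng y -> m y = rng z ->
  let X := act x y in let Y := coact x y in let Z := coact X z in
  [/\ act X z = act x (act y z), act Y Z = coact x (act y z)
    & coact Y Z = coact y z].
Proof.
move=> xy yz X Y Z.
have Xz : m X = rng z by rewrite middle_act.
have YZ : m Y = rng Z by rewrite rng_coact // src_act.
have e : coact Y Z = coact y z.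
  have c1 : src (p2 X) = rng (p2 Y) by rewrite src_p2 src_act // rng_p2.
  rewrite /coact -(p2_act xy) ginvM // -gmulA ?src_inv ?rng_inv //.
  by rewrite rng_p2.
have e2 : act Y Z = coact x (act y z).
  by rewrite /act e [RHS]gmulA ?(src_p2V xy) ?(src_act_def yz).
split=> //; rewrite [RHS]/act -e2 [LHS]/act -/Z.
have c4 : src Y = rng (p1 (coact Y Z)) by rewrite (src_act_def YZ).
have c5 : src (p2 Y) = rng (p1 (coact Y Z)) by rewrite src_p2.
have c6 : src (p1 Y) = rng (gmul (p2 Y) (p1 (coact Y Z))).
  by rewrite rng_mul ?src_p1.
have ZE : Z = gmul (gmul (p2 Y) (p1 (coact Y Z))) (p2 (coact Y Z)).
  by rewrite -gmulA ?src_p1 // decompE p2_coact.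
have -> : act Y Z = gmul (p1 Y) (gmul (p2 Y) (p1 (coact Y Z))).
  by rewrite gmulA ?src_p1 // decompE.
have [-> _] := decomp_mulH (p1_in Y) c6.
have [||<- _] := @decomp_mulK (gmul (p2 Y) (p1 (coact Y Z))) (p2 (coact Y Z)).
- exact: p2_in.
- by rewrite src_mul // src_p1.
rewrite -ZE [RHS]gmulA ?(src_act_def xy) //.
by rewrite rng_p1 src_p1 rng_p2 YZ.
Qed.

(** With x = hk = k'h', this is h^-1 k' : the factor k' is the inverse of the
    K-component of x^-1 = h'^-1 k'^-1. *)
Definition twist x := gmul (ginv (p1 x)) (ginv (p2 (ginv x))).

Lemma twist_def x : src (ginv (p1 x)) = rng (ginv (p2 (ginv x))).
Proof. by rewrite src_inv rng_inv rng_p1 src_p2 src_inv. Qed.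

Lemma rng_twist x : rng (twist x) = m x.
Proof. by rewrite rng_mul ?twist_def // rng_inv. Qed.

(** By uniqueness of decompositions, twist x = h^-1 k' and (twist x)^-1 = h' k^-1
    exhibit the components h^-1 of twist x and k^-1 of its inverse, so twisting
    again gives hk = x. *)
Lemma twistK : involutive twist.
Proof.
move=> x.
have [HV _] := subgroupoid_l; have [KV _] := subgroupoid_r.
have [e1 _] := decomp_uniq HK (HV _ (p1_in x)) (KV _ (p2_in (ginv x)))
  (twist_def x).
(* The same arrow in the opposite order: the inverse of twist x is h' k^-1. *)
have c : src (p1 (ginv x)) = rng (p2 (ginv x)) by exact: src_p1.
have d : src (ginv (p1 (ginv x))) = rng (ginv (p2 x)).
  by rewrite src_inv rng_inv rng_p1 src_p2 rng_inv.
have e : ginv (twist x) = gmul (ginv (p1 (ginv x))) (ginv (p2 x)).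
  rewrite /twist ginvM ?twist_def // !ginvK.
  have -> : p1 x = gmul x (ginv (p2 x)) by rewrite -{2}(decompE x) gmulgK ?src_p1.
  have -> : p2 (ginv x) = gmul (ginv (p1 (ginv x))) (ginv x).
    by rewrite -{3}(decompE (ginv x)) gmulKg.
  rewrite -gmulA ?src_inv ?rng_inv ?rng_p1 ?rng_inv //; last first.
    by rewrite rng_mul ?rng_inv ?src_p2.
  by rewrite gmulKg // rng_inv src_p2.
have [_ e2] := decomp_uniq HK (HV _ (p1_in (ginv x))) (KV _ (p2_in x)) d.
by rewrite {1}/twist e e2 [p1 _]e1 !ginvK decompE.
Qed.

Lemma middle_twist x : m (twist x) = rng x.
Proof. by rewrite -rng_twist twistK. Qed.

End MatchPair.

(** * Multiplication operators and partial pullbacks *)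

Section Operators.
Variable R : realType.

Lemma mulopE (U X : finType) (phi : X -> U) n (f : l2 R X) x :
  mulop R phi n f x = n (phi x) * f x.
Proof. by rewrite lfunE ffunE. Qed.

Lemma dotp_diracr (X : finType) (f : l2 R X) x : dotp f (dirac R x) = f x.
Proof.
rewrite /dotp (bigD1 x) //= ffunE eqxx rmorph1 mulr1 big1 ?addr0 // => y yx.
by rewrite ffunE (negPf yx) rmorph0 mulr0.
Qed.

Lemma adjointE (X : finType) (T : 'End(l2 R X)) g x :
  adjoint T g x = dotp g (T (dirac R x)).
Proof. by rewrite lfunE ffunE. Qed.

Lemma trace_mulop (U X : finType) (phi : X -> U) n :
  trace (mulop R phi n) = \sum_x n (phi x).
Proof.
apply: eq_bigr => x _.
by rewrite dotp_diracr mulopE ffunE eqxx mulr1.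
Qed.

Lemma mulop_representation (U X : finType) (phi : X -> U) :
  representation (mulop R phi).
Proof.
split=> [c n n'|n n'|n].
- apply/lfunP=> f; apply/ffunP=> x.
  by rewrite !lfunE /= !lfunE !ffunE mulrDl mulopE -scalerAl.
- apply/lfunP=> f; apply/ffunP=> x.
  by rewrite comp_lfunE !mulopE ffunE mulrA.
- apply/lfunP=> f; apply/ffunP=> x; rewrite adjointE mulopE ffunE.
  rewrite /dotp (bigD1 x) //= mulopE ffunE eqxx mulr1 mulrC.
  rewrite big1 ?addr0 // => y yx.
  by rewrite mulopE ffunE (negPf yx) mulr0 rmorph0 mulr0.
Qed.

Lemma mulop_inj (U X : finType) (phi : X -> U) :
  (forall u, exists x, phi x = u) -> injective (mulop R phi).
Proof.
move=> phi_surj n n' /lfunP e; apply/ffunP=> u; have [x <-] := phi_surj u.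
by have /ffunP/(_ x) := e (dirac R x); rewrite !mulopE ffunE eqxx !mulr1.
Qed.

Lemma mulop_nondegenerate (U X : finType) (phi : X -> U) :
  Defs.nondegenerate (mulop R phi).
Proof.
move=> f; exists [:: ([ffun=> 1], f)]; rewrite big_seq1.
by apply/ffunP=> x; rewrite mulopE ffunE mul1r.
Qed.

Lemma mulop_commuting (U X : finType) (phi psi : X -> U) :
  commuting (mulop R phi) (mulop R psi).
Proof.
move=> n n'; apply/lfunP=> f; apply/ffunP=> x.
by rewrite !lfunE /= !mulopE mulrCA.
Qed.

Lemma tens_mulop (U V X Y : finType) (phi : X -> U) (psi : Y -> V) n n'
    (F : l2 R (X * Y)) q :
  tens (mulop R phi n) (mulop R psi n') F q
  = n (phi q.1) * (n' (psi q.2) * F q).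
Proof. by rewrite lfunE ffunE mulopE ffunE mulopE ffunE -surjective_pairing. Qed.

(** The operators treated below are not given as pullbacks, hence a predicate
    on operators and not a construction of them. *)
Definition pullback (X : finType) (T : 'End(l2 R X)) (D : pred X)
    (t : X -> X) : Prop :=
  forall F x, T F x = if D x then F (t x) else 0.

Lemma e_pullback (U X : finType) (phi psi : X -> U) :
  pullback (e_ (mulop R phi) (mulop R psi))
    (fun q => phi q.1 == psi q.2) id.
Proof.
move=> F q; rewrite sum_lfunE sum_ffunE.
rewrite (eq_bigr (fun u => (u == phi q.1)%:R * ((u == psi q.2)%:R * F q))).
  rewrite (bigD1 (phi q.1)) //= eqxx mul1r big1 ?addr0 => [|u]; last first.
    by move=> /negPf->; rewrite mul0r.
  by case: eqP => _; rewrite ?mul1r ?mul0r.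
move=> u _; rewrite tens_mulop !ffunE.
by rewrite ![_ == u]eq_sym.
Qed.

Section PartialBijection.
Variables (X : finType) (T : 'End(l2 R X)) (D E : pred X) (t t' : X -> X).
Hypothesis TP : pullback T D t.
Hypothesis tD : forall x, D x -> E (t x).
Hypothesis tK : forall x, D x -> t' (t x) = x.
Hypothesis tE : forall x, E x -> D (t' x).
Hypothesis tKV : forall x, E x -> t (t' x) = x.

(** T sends the basis vector at x to the one at t'(x) if x is in E, and
    to 0 otherwise. *)
Lemma adjoint_pullback : pullback (adjoint T) E t'.
Proof.
move=> F x; rewrite adjointE.
case: ifP => [Ex|nEx].
  suff -> : T (dirac R x) = dirac R (t' x) by rewrite dotp_diracr.
  apply/ffunP=> y; rewrite TP !ffunE.
  have [->|yx] := eqVneq y (t' x); first by rewrite tE // tKV // eqxx.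
  case: ifP => // Dy; case: eqP => // tyx.
  by rewrite -tyx tK ?eqxx in yx.
rewrite /dotp big1 // => y _; rewrite TP.
case: ifP => [Dy|_]; last by rewrite rmorph0 mulr0.
rewrite ffunE; case: eqP => [tyx|_]; last by rewrite rmorph0 mulr0.
by rewrite -tyx tD in nEx.
Qed.

Lemma pullback_initial : pullback (adjoint T \o T)%VF E id.
Proof.
move=> F x; rewrite lfunE /= adjoint_pullback.
by case: ifP => // Ex; rewrite TP tE // tKV.
Qed.

Lemma pullback_final : pullback (T \o adjoint T)%VF D id.
Proof.
move=> F x; rewrite lfunE /= TP.
by case: ifP => // Dx; rewrite adjoint_pullback tD // tK.
Qed.

(** Since T T* T = T, the vector f - T*T f lies in the kernel of T. *)
Lemma pullback_partial_isometry : partial_isometry T.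
Proof.
move=> f f_orth; rewrite adjointP.
have TTT : T (f - adjoint T (T f)) = 0.
  apply/ffunP=> x; rewrite linearB /= !ffunE.
  have := pullback_final (T f) x; rewrite lfunE /= => ->.
  by rewrite TP; case: ifP => _; rewrite subrr.
apply/esym/eqP; rewrite -subr_eq0 -(f_orth _ TTT) /dotp -sumrB.
by apply/eqP/eq_bigr => x _; rewrite !ffunE rmorphB mulrBr.
Qed.

End PartialBijection.

Lemma pullback_uniq (X : finType) (S T : 'End(l2 R X)) (D : pred X) t :
  pullback S D t -> pullback T D t -> S = T.
Proof. by move=> SP TP; apply/lfunP=> F; apply/ffunP=> x; rewrite SP TP. Qed.

Section Legs.
Variables (X : finType) (T : 'End(l2 R (X * X))).
Variables (D : pred (X * X)) (t : X * X -> X * X).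
Hypothesis TP : pullback T D t.

Lemma leg12_pullback F x y z : leg12 T F (x, y, z) =
  if D (x, y) then F ((t (x, y)).1, (t (x, y)).2, z) else 0.
Proof. by rewrite lfunE ffunE TP ffunE. Qed.

Lemma leg13_pullback F x y z : leg13 T F (x, y, z) =
  if D (x, z) then F ((t (x, z)).1, y, (t (x, z)).2) else 0.
Proof. by rewrite lfunE ffunE TP ffunE. Qed.

Lemma leg23_pullback F x y z : leg23 T F (x, y, z) =
  if D (y, z) then F (x, (t (y, z)).1, (t (y, z)).2) else 0.
Proof. by rewrite lfunE ffunE TP ffunE. Qed.

End Legs.

(** * The operator of a match pair *)

Section MatchPairOperator.
Variables (G : finGroupoid) (H K : {set G}).
Hypothesis HK : match_pair H K.

Lemma I_pullback : pullback (I_op R H K)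
  (fun q => middle H K q.1 == rng q.2)
  (fun q => (act H K q.1 q.2, coact H K q.1 q.2)).
Proof. by move=> F [x y]; rewrite lfunE ffunE. Qed.

Lemma match_pair_base : mpi_base (mulop R (middle H K)) (mulop R (@rng G))
  (mulop R (@src G)).
Proof.
split.
- by split; apply: mulop_representation.
- split; apply: mulop_inj => u.
  + by exists (twist H K (gunit u)); rewrite middle_twist // rng_unit.
  + by exists (gunit u); rewrite rng_unit.
  + by exists (gunit u); rewrite src_unit.
- by split; apply: mulop_nondegenerate.
- by split; apply: mulop_commuting.
move=> n; rewrite !trace_mulop; split.
  rewrite (reindex_inj (inv_inj (twistK HK))) /=.
  by apply: eq_bigr => x _; rewrite middle_twist.
rewrite (reindex_inj (inv_inj (@ginvK G))) /=.
by apply: eq_bigr => x _; rewrite rng_inv.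
Qed.

Lemma I_op_pentagon : let I := I_op R H K in
  (leg12 I \o leg13 I \o leg23 I)%VF = (leg23 I \o leg12 I)%VF.
Proof.
move=> I; apply/lfunP=> F; apply/ffunP=> -[[x y] z].
rewrite !comp_lfunE (leg12_pullback I_pullback) (leg23_pullback I_pullback) /=.
rewrite (leg13_pullback I_pullback) (leg23_pullback I_pullback) /=.
rewrite (leg12_pullback I_pullback) /=.
case: (eqVneq (middle H K y) (rng z)) => [yz|yz]; last first.
  by case: eqP => // xy; rewrite (middle_act HK xy) (negPf yz).
rewrite (rng_act HK yz); case: eqP => // xy.
rewrite (middle_act HK xy) yz eqxx.
have Xz : middle H K (act H K x y) = rng z by rewrite middle_act.
rewrite (rng_coact HK Xz) (src_act HK xy) eqxx.
by have [-> -> ->] := pentagon_arrows HK xy yz.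
Qed.

End MatchPairOperator.

End Operators.

Theorem proposition4p1p6 (R : realType) (G : finGroupoid) (H K : {set G})
    (HK : match_pair H K) :
  mult_partial_isometry (mulop R (middle H K)) (mulop R (@rng G))
    (mulop R (@src G)) (I_op R H K).
Proof.
pose E (q : G * G) := src q.1 == middle H K q.2.
pose t' (q : G * G) := (unact H K q.1 q.2, uncoact H K q.1 q.2).
have IP := @I_pullback R G H K.
set D := (D in pullback _ D _) in IP; set t := (t in pullback _ _ t) in IP.
have tD q : D q -> E (t q) by move=> /eqP q12; rewrite /E src_act.
have tK q : D q -> t' (t q) = q.
  by case: q => x y /eqP q12; have [] := actK HK q12; rewrite /t' /= => -> ->.
have tE q : E q -> D (t' q) by move=> /eqP q12; rewrite /D rng_uncoact.
have tKV q : E q -> t (t' q) = q.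
  by case: q => x y /eqP q12; have [] := coactK HK q12; rewrite /t /= => -> ->.
split.
- exact: match_pair_base.
- exact: pullback_partial_isometry IP tD tK tE tKV.
- exact: pullback_uniq (pullback_initial IP tD tK tE tKV) (e_pullback _ _).
- exact: pullback_uniq (pullback_final IP tD tK tE tKV) (e_pullback _ _).
- move=> n n'; apply/lfunP=> F; apply/ffunP=> -[x y].
  rewrite !comp_lfunE IP !tens_mulop IP; case: ifP => [/eqP xy|_].
    by rewrite /= rng_act // src_coact.
  by rewrite !mulr0.
- move=> n n'; apply/lfunP=> F; apply/ffunP=> -[x y].
  rewrite !comp_lfunE IP !tens_mulop IP; case: ifP => [/eqP xy|_].
    by rewrite /= middle_act // rng_coact // mulrCA.
  by rewrite !mulr0.
- exact: I_op_pentagon.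
Qed.
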